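(* Let $n\ge3$, and let $\Sigma\subseteq\mathrm{Gr}(1,\mathbb{P}^n)$ be an irreducible hypersurface, given by a homogeneous polynomial $Q$ in dual Plücker coordinates. Then $\Sigma$ is coisotropic if and only if for all $0\le i<m\le n$, the following polynomial in dual Plücker coordinates vanishes everywhere on $\Sigma$: $$\forall L\in\Sigma:\quad\left(\sum_{0\le j<k\le n,\ j,k\notin\{i,m\}}q_{jk}\,R^Q_{jkim}\right)(L)=0.$$
   Context: Everything is over $\mathbb{C}$. $\mathrm{Gr}(1,\mathbb{P}^n)$ is the Grassmannian of lines in $\mathbb{P}^n$. If a line $L$ is the projectivization of the row space of a matrix $B\in\mathbb{C}^{2\times(n+1)}$ (columns indexed $0,\ldots,n$), its dual Plücker coordinates are the $2\times2$ minors $q_{jk}$ of $B$ ($0\le j<k\le n$), formed by the columns $j,k$. An irreducible hypersurface $\Sigma\subseteq\mathrm{Gr}(1,\mathbb{P}^n)$ is defined by one polynomial in the coordinate ring of the Grassmannian, unique up to a constant factor; ''$\Sigma$ is given by $Q$'' means that $Q$ is a homogeneous irreducible polynomial in the variables $q_{jk}$ representing this defining polynomial (i.e. its class generates the ideal of $\Sigma$ in the coordinate ring). For $0\le j<k<i<m\le n$ define $$R^Q_{jkim}:=\frac{\partial Q}{\partial q_{jk}}\cdot\frac{\partial Q}{\partial q_{im}}-\frac{\partial Q}{\partial q_{ji}}\cdot\frac{\partial Q}{\partial q_{km}}+\frac{\partial Q}{\partial q_{jm}}\cdot\frac{\partial Q}{\partial q_{ki}},$$ and for arbitrary orders of the four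 distinct indices set $R^Q_{\pi(jkim)}:=\mathrm{sgn}(\pi)R^Q_{jkim}$ for $\pi\in S_4$. Evaluation at $L$ means evaluation at the dual Plücker coordinates of $L$. Coisotropy: Let $U,V$ be finite-dimensional vector spaces and $W:=\mathrm{Hom}(U,V)$; identify $W^\ast$ with $\mathrm{Hom}(V,U)$ via $\phi\mapsto\mathrm{tr}(\,\cdot\circ\phi)$. A hyperplane $H\subseteq W$ is coisotropic if its defining equation, viewed in $\mathrm{Hom}(V,U)$, has rank one. For $L=\mathbb{P}(U)\in\mathrm{Gr}(l,\mathbb{P}^n)$, one has $T_L\mathrm{Gr}(l,\mathbb{P}^n)\cong\mathrm{Hom}(U,\mathbb{C}^{n+1}/U)$. An irreducible hypersurface $\Sigma\subseteq\mathrm{Gr}(l,\mathbb{P}^n)$ is coisotropic if for every smooth $L\in\Sigma$ the tangent hyperplane $T_L\Sigma$ is coisotropic in $T_L\mathrm{Gr}(l,\mathbb{P}^n)$. *)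

(* Defs.v *)
From HB Require Import structures.
From mathcomp Require Import all_boot all_order all_fingroup all_algebra.
From mathcomp Require Import reals complex mpoly.

Set Implicit Arguments.
Unset Strict Implicit.
Unset Printing Implicit Defensive.

Import GRing.Theory.
Local Open Scope ring_scope.

Section Coisotropic.
Variables (F : fieldType) (U V : vectType F).

Definition lftrace (f : 'End(V)) : F :=
  \tr (passmx.mxof (vbasis {:V}) (vbasis {:V}) f).

Definition is_hyperplane (W : vectType F) (H : {vspace W}) : Prop :=
  (\dim H).+1 = \dim {:W}.

(* psi : V -> U is the equation of H under the identification of Hom(V, U)
   with the dual of Hom(U, V) given by the trace pairing. *)
Definition hyperplane_coisotropic (H : {vspace 'Hom(U, V)}) : Prop :=
  is_hyperplane H /\
  exists psi : 'Hom(V, U),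
    \dim (limg psi) = 1%N /\
    forall phi : 'Hom(U, V), (phi \in H) <-> lftrace (phi \o psi)%VF = 0.

End Coisotropic.

(* The library has no quotients of vector spaces; vT / U is modelled by
   the complement U^C together with the projection along U.  quotv_proj_ker and quotv_proj_onto characterize it up
   to unique isomorphism. *)
Section Quotient.
Variables (F : fieldType) (vT : vectType F) (U : {vspace vT}).

Definition quotv : vectType F := subvs_of (U^C)%VS.

Definition quotv_proj : 'Hom(vT, quotv) :=
  (linfun (vsproj (U^C)%VS) \o (\1 - projv U))%VF.

Lemma val_quotv_proj (v : vT) : vsval (quotv_proj v) = v - projv U v.
Proof.
rewrite comp_lfunE lfunE add_lfunE opp_lfunE id_lfunE /= vsprojK //.
exact: memv_projC.
Qed.

Lemma quotv_proj_ker : lker quotv_proj = U.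
Proof.
apply/vspaceP => v; rewrite memv_ker -(inj_eq val_inj) /= val_quotv_proj.
rewrite subr_eq0; apply/eqP/idP => [->|vU]; first exact: memv_proj.
by rewrite projv_id.
Qed.

Lemma quotv_proj_onto : limg quotv_proj = fullv.
Proof.
apply/vspaceP => w; rewrite memvf; apply/memv_imgP.
exists (vsval w); first exact: memvf.
apply: val_inj; rewrite /= val_quotv_proj.
suff -> : projv U (vsval w) = 0 by rewrite subr0.
by apply/eqP; rewrite -memv_ker lker_proj subvsP.
Qed.

End Quotient.

Section Lines.
Variables (F : fieldType) (n : nat).

Record line := Line {
  line_space :> {vspace 'rV[F]_n.+1};
  _ : \dim line_space == 2 }.

Definition spans (B : 'M[F]_(2, n.+1)) (L : line) : Prop :=
  <<[seq row a B | a : 'I_2]>>%VS = line_space L.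

(* The variables q_jk are indexed by the pairs j < k, enumerated as 'I_N since
   multivariate polynomials have variables indexed by an ordinal type. *)
Definition plucker_idx : predArgType :=
  {jk : 'I_n.+1 * 'I_n.+1 | (jk.1 < jk.2)%N}.

Definition ppoly := {mpoly F[#|plucker_idx|]}.

Definition minor2 (A : comNzRingType) (B : 'M[A]_(2, n.+1)) (j k : 'I_n.+1) :
  A := \det (colsub (fun b : 'I_2 => if b == 0 then j else k) B).

Definition plucker (A : comNzRingType) (B : 'M[A]_(2, n.+1))
    (x : 'I_#|plucker_idx|) : A :=
  let jk := val (enum_val x) in minor2 B jk.1 jk.2.

(* Plucker coordinates of L are defined up to a scalar; quantifying over all
   B makes this right for non-homogeneous P as well: P vanishes on the line of
   the affine cone over L. *)
Definition vanishes (P : ppoly) (L : line) : Prop :=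
  forall B : 'M[F]_(2, n.+1), spans B L -> P.@[plucker B] = 0.

Definition vanishes_on (P : ppoly) (Z : line -> Prop) : Prop :=
  forall L, Z L -> vanishes P L.

Definition zariski_closed (Z : line -> Prop) : Prop :=
  exists S : ppoly -> Prop,
    (forall P, S P -> exists d, P \is d.-homog) /\
    (forall L, Z L <-> forall P, S P -> vanishes P L).

Definition irreducible_closed (Z : line -> Prop) : Prop :=
  [/\ zariski_closed Z, exists L, Z L &
      forall Z1 Z2 : line -> Prop,
        zariski_closed Z1 -> zariski_closed Z2 ->
        (forall L, Z L -> Z1 L \/ Z2 L) ->
        (forall L, Z L -> Z1 L) \/ (forall L, Z L -> Z2 L)].

(* The last two clauses say that the codimension is 1: the only irreducible
   closed set properly containing Sigma is the whole Grassmannian. *)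
Definition irreducible_hypersurface (Sigma : line -> Prop) : Prop :=
  [/\ irreducible_closed Sigma,
      exists L, ~ Sigma L &
      forall Z : line -> Prop, irreducible_closed Z ->
        (forall L, Sigma L -> Z L) ->
        (forall L, Z L -> Sigma L) \/ (forall L, Z L)].

Definition irreducible_mpoly (Q : ppoly) : Prop :=
  [/\ Q != 0, Q \isn't a GRing.unit &
      forall P1 P2 : ppoly, Q = P1 * P2 ->
        P1 \is a GRing.unit \/ P2 \is a GRing.unit].

(* The coordinate ring of the Grassmannian is ppoly modulo the polynomials
   vanishing at all lines; the last clause says that the class of Q generates
   the ideal of Sigma in this ring. *)
Definition given_by (Sigma : line -> Prop) (Q : ppoly) : Prop :=
  [/\ exists d, Q \is d.-homog, irreducible_mpoly Q &
      forall P : ppoly, vanishes_on P Sigma <->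
        exists A : ppoly, vanishes_on (P - A * Q) (fun _ => True)].

(* The curve t |-> span (B + t D), as a matrix over the polynomials in t. *)
Definition pencil (B D : 'M[F]_(2, n.+1)) : 'M[{poly F}]_(2, n.+1) :=
  map_mx polyC B + 'X *: map_mx polyC D.

Definition dir_deriv (P : ppoly) (B D : 'M[F]_(2, n.+1)) : F :=
  (mmap polyC (plucker (pencil B D)) P)^`().[0].

Notation Tgr L := ('Hom(subvs_of (line_space L), quotv (line_space L))).

(* phi : L -> F^(n+1) / L is the tangent vector at t = 0 of the curve
   t |-> (id + t phi')(L), for any lift phi' : L -> F^(n+1) of phi; the rows
   of D below are the images under phi' of the rows of B. *)
Definition tangent_vector (Sigma : line -> Prop) (L : line) (phi : Tgr L) :
    Prop :=
  forall (P : ppoly), vanishes_on P Sigma ->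
  forall B D : 'M[F]_(2, n.+1), spans B L ->
    (forall a : 'I_2, quotv_proj L (row a D) = phi (vsproj L (row a B))) ->
    dir_deriv P B D = 0.

Definition is_tangent_space (Sigma : line -> Prop) (L : line)
    (T : {vspace Tgr L}) : Prop :=
  forall phi : Tgr L, (phi \in T) <-> tangent_vector Sigma phi.

(* Used for hypersurfaces only: their dimension is one less than that of the
   Grassmannian, so L is smooth iff the Zariski tangent space is a
   hyperplane. *)
Definition smooth_point (Sigma : line -> Prop) (L : line) : Prop :=
  Sigma L /\
  exists T : {vspace Tgr L}, is_tangent_space Sigma T /\ is_hyperplane T.

Definition coisotropic (Sigma : line -> Prop) : Prop :=
  forall L : line, smooth_point Sigma L ->
  forall T : {vspace Tgr L}, is_tangent_space Sigma T ->
    hyperplane_coisotropic T.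

(* 0 is a junk value, for j >= k. *)
Definition qvar (j k : 'I_n.+1) : ppoly :=
  if insub (j, k) is Some x then 'X_(enum_rank (x : plucker_idx)) else 0.

Definition dq (Q : ppoly) (j k : 'I_n.+1) : ppoly :=
  if insub (j, k) is Some x then Q^`M(enum_rank (x : plucker_idx)) else 0.

Definition Rsorted (Q : ppoly) (j k i m : 'I_n.+1) : ppoly :=
  dq Q j k * dq Q i m - dq Q j i * dq Q k m + dq Q j m * dq Q k i.

(* For distinct indices, exactly one permutation s sorts them increasingly, so
   that the sum has exactly one term. *)
Definition Rpoly (Q : ppoly) (j k i m : 'I_n.+1) : ppoly :=
  let t := tnth [tuple j; k; i; m] in
  \sum_(s : 'S_4 | [forall a : 'I_4, forall b : 'I_4,
                     (a < b)%N ==> (t (s a) < t (s b))%N])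
    (-1) ^+ s * Rsorted Q (t (s 0)) (t (s 1)) (t (s 2)) (t (s 3)).

Definition coisotropy_poly (Q : ppoly) (i m : 'I_n.+1) : ppoly :=
  \sum_(j < n.+1 | j \notin [:: i; m])
    \sum_(k < n.+1 | (j < k)%N && (k \notin [:: i; m]))
      qvar j k * Rpoly Q j k i m.

End Lines.

(* Main.v *)
From HB Require Import structures.
Require Import Defs.
From mathcomp Require Import all_boot all_order all_fingroup all_algebra.
From mathcomp Require Import reals complex mpoly ring.

Set Implicit Arguments.
Unset Strict Implicit.
Unset Printing Implicit Defensive.

Import GRing.Theory.
Local Open Scope ring_scope.

(* Let L be a line of Sigma spanned by the rows a, b of B, and let M be the
   antisymmetric matrix of partial derivatives of Q at the Plucker coordinates
   of B.  The derivative of Q at B in the direction D, with rows D0 and D1, is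
   D0 M b^T - D1 M a^T.  Hence L is smooth iff M a^T and M b^T are not both
   zero, and the tangent hyperplane is then coisotropic iff they are linearly
   dependent.  As R^Q_jkim is the Pfaffian of M on the indices j, k, i, m, the
   given polynomial takes the value
     M_im (a M b^T) - ((M a^T)_i (M b^T)_m - (M a^T)_m (M b^T)_i)
   at L, where a M b^T = 0 because Q vanishes on the basis ((1 + t) a, b) of L
   for all t <> -1.  At singular lines of Sigma all these minors vanish
   trivially, so that no density argument is needed. *)

(** * Pfaffians on four indices, and [Rpoly] as such a Pfaffian *)

Section Pfaffian.
Variables (A : comNzRingType) (I : Type) (M : I -> I -> A).
Hypothesis M_anti : forall j k, M k j = - M j k.

Definition pfaffian4 (j k i m : I) : A :=
  M j k * M i m - M j i * M k m + M j m * M k i.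

Lemma pfaffian4_tperm (t : 'I_4 -> I) (x y : 'I_4) : x != y ->
  pfaffian4 (t (tperm x y 0)) (t (tperm x y 1)) (t (tperm x y 2))
    (t (tperm x y 3)) = - pfaffian4 (t 0) (t 1) (t 2) (t 3).
Proof.
have ord4 (z : 'I_4) : [\/ z = 0, z = 1, z = 2 | z = 3].
  case: z => [[|[|[|[|//]]]]] lt4; [apply: Or41|apply: Or42|apply: Or43|apply: Or44];
  exact: val_inj.
case: (ord4 x) (ord4 y) => [] -> [] -> // _; rewrite !permE /= /pfaffian4;
rewrite ?(M_anti (t 0) (t 1)) ?(M_anti (t 0) (t 2)) ?(M_anti (t 0) (t 3));
rewrite ?(M_anti (t 1) (t 2)) ?(M_anti (t 1) (t 3)) ?(M_anti (t 2) (t 3)); ring.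
Qed.

(** Induction on a factorization of [s] into transpositions, each of which contributes one sign. *)
Lemma pfaffian4_perm (t : 'I_4 -> I) (s : 'S_4) :
  pfaffian4 (t (s 0)) (t (s 1)) (t (s 2)) (t (s 3)) =
  (-1) ^+ s * pfaffian4 (t 0) (t 1) (t 2) (t 3).
Proof.
have [ts -> dts] := prod_tpermP s.
elim: ts dts => [_|[x y] ts IH /= /andP[dxy dts]].
  by rewrite big_nil !permE odd_perm1 expr0 mul1r.
rewrite big_cons !permM odd_permM odd_tperm dxy signr_addb -mulrA -IH //.
(* A product of permutations applies its left factor first, so the leading transposition acts on the
   positions and the remaining product is absorbed into [t]. *)
by rewrite (pfaffian4_tperm (t \o (\prod_(z <- ts) tperm z.1 z.2)%g)) //= mulN1r.
Qed.

End Pfaffian.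

(** The condition says that the list [v s'] of values is strictly sorted. All these lists have the
    same members, so only one of them can be sorted, and sorting the values of [t] produces it. This
    makes the sum in [Rpoly] a single term. *)
Lemma sorting_perm_uniq (r n : nat) (t : 'I_r -> 'I_n) :
  injective t ->
  exists s : 'S_r, forall s' : 'S_r,
    [forall a : 'I_r, forall b : 'I_r, (a < b)%N ==> (t (s' a) < t (s' b))%N] =
    (s' == s).
Proof.
move=> t_inj; pose v (s : 'S_r) := [seq val (t (s a)) | a <- enum 'I_r].
have size_v s : size (v s) = r by rewrite size_map size_enum_ord.
have nth_v (s : 'S_r) (a : 'I_r) : nth 0%N (v s) a = t (s a).
  by rewrite (nth_map a) ?size_enum_ord ?nth_ord_enum.
have v_sorted (s : 'S_r) : [forall a : 'I_r, forall b : 'I_r,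
    (a < b)%N ==> (t (s a) < t (s b))%N] = sorted ltn (v s).
  apply/idP/idP => [/forallP lt_s|sv].
    apply/(sortedP 0%N) => a; rewrite size_v => lt_a.
    have := lt_s (Ordinal (ltnW lt_a)).
    move=> /forallP /(_ (Ordinal lt_a)) /implyP /(_ (ltnSn _)).
    by rewrite -!nth_v.
  apply/forallP => a; apply/forallP => b; apply/implyP => lt_ab.
  by rewrite -!nth_v; apply: (sorted_ltn_nth ltn_trans) => //; rewrite inE size_v.
have v_mem (s : 'S_r) x : (x \in v s) = (x \in codom (val \o t)).
  apply/mapP/codomP => -[a] => [_ ->|->]; first by exists (s a).
  by exists ((s^-1)%g a); rewrite ?mem_enum //= permKV.
have v_inj : injective v.
  move=> s1 s2 eq_v; apply/permP => a; apply/t_inj/val_inj.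
  by rewrite /= -!nth_v eq_v.
have [s v_s] : exists s, sort leq [tuple val (t a) | a < r] = v s.
  have := permEl (perm_sort leq [tuple val (t a) | a < r]).
  case/tuple_permP => s ->; exists s; rewrite /v /=.
  by apply: eq_map => a; rewrite tnth_mktuple.
have s_sorted : sorted ltn (v s).
  rewrite ltn_sorted_uniq_leq -v_s sort_uniq sort_sorted ?andbT; last exact: leq_total.
  by rewrite map_inj_uniq ?enum_uniq // => a b /val_inj/t_inj.
exists s => s'; rewrite v_sorted; apply/idP/eqP => [sv|->//].
apply/v_inj/(irr_sorted_eq ltn_trans ltnn) => // x.
by rewrite !v_mem.
Qed.

Lemma dq_ge (F : fieldType) (n : nat) (Q : ppoly F n) (j k : 'I_n.+1) :
  (k <= j)%N -> dq Q j k = 0.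
Proof. by move=> le_kj; rewrite /dq insubF //= ltnNge le_kj. Qed.

(** As [dq] vanishes off the range j < k, the antisymmetrized derivative agrees with [dq] on sorted
    pairs. The sign in [Rpoly] then cancels the sign by which the Pfaffian changes under sorting. *)
Lemma Rpoly_pfaffian (F : fieldType) (n : nat) (Q : ppoly F n) (j k i m : 'I_n.+1) :
  uniq [:: j; k; i; m] ->
  Rpoly Q j k i m = pfaffian4 (fun x y => dq Q x y - dq Q y x) j k i m.
Proof.
move=> u; rewrite /Rpoly.
set t := tnth _.
have t_inj : injective t by apply/tuple_uniqP.
have [s sP] := sorting_perm_uniq t_inj.
rewrite (big_pred1 s) //=.
have /forallP lt_s : [forall a : 'I_4, forall b : 'I_4, (a < b)%N ==> (t (s a) < t (s b))%N].
  by rewrite sP.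
have lt (x y : 'I_4) : (x < y)%N -> dq Q (t (s y)) (t (s x)) = 0.
  by move=> lt_xy; apply/dq_ge/ltnW; have /forallP/(_ y)/implyP/(_ lt_xy) := lt_s x.
have M_anti x y : dq Q y x - dq Q x y = - (dq Q x y - dq Q y x).
  by rewrite opprB.
have -> : Rsorted Q (t (s 0)) (t (s 1)) (t (s 2)) (t (s 3)) =
   pfaffian4 (fun x y => dq Q x y - dq Q y x) (t (s 0)) (t (s 1)) (t (s 2)) (t (s 3)).
  by rewrite /Rsorted /pfaffian4 (lt 0 1) // (lt 2 3) // (lt 0 2) // (lt 1 3) //
     (lt 0 3) // (lt 1 2) // !subr0.
by rewrite (pfaffian4_perm M_anti) mulrA -signr_addb addbb mul1r.
Qed.

(** * Sums over pairs of indices, and minors *)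

Lemma big_plucker_idx (A : nmodType) (n : nat) (f : 'I_n.+1 -> 'I_n.+1 -> A) :
  \sum_(x < #|plucker_idx n|) f (val (enum_val x)).1 (val (enum_val x)).2 =
  \sum_(j < n.+1) \sum_(k < n.+1 | (j < k)%N) f j k.
Proof.
rewrite pair_big_dep /= (reindex_omap (val : plucker_idx n -> _) insub) /=.
  rewrite -(big_enum_val (A := {: plucker_idx n})
    (fun z : plucker_idx n => f (val z).1 (val z).2)) /=.
  apply: eq_bigl => -[[j k] lt_jk]; rewrite inE insubT eqxx andbT /=.
  by rewrite lt_jk.
by move=> [j k] /= lt_jk; rewrite insubT.
Qed.

(** Antisymmetry folds the terms below the diagonal onto those above it. The diagonal has its own
    hypothesis because antisymmetry does not imply it in characteristic 2. *)
Lemma sum_lt_antisym (A : pzRingType) (n : nat) (f g : 'I_n -> 'I_n -> A) :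
  (forall j, g j j = 0) -> (forall j k, g k j = - g j k) ->
  \sum_(j < n) \sum_(k < n | (j < k)%N) (f j k - f k j) * g j k =
  \sum_(j < n) \sum_(k < n) f j k * g j k.
Proof.
move=> g0 gN.
have split_lt j : \sum_(k < n) f j k * g j k =
    \sum_(k < n | (j < k)%N) f j k * g j k + \sum_(k < n | (k < j)%N) f j k * g j k.
  rewrite (bigID (fun k : 'I_n => (j < k)%N)) /=; congr (_ + _).
  rewrite (bigD1 j) ?ltnn //= g0 mulr0 add0r; apply: eq_bigl => k.
  by rewrite -leqNgt ltn_neqAle andbC.
rewrite [RHS](eq_bigr _ (fun j _ => split_lt j)) big_split /=.
rewrite [X in _ + X](exchange_big_dep predT) //= -big_split; apply: eq_bigr => j _.
rewrite -big_split; apply: eq_bigr => k _ /=.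
by rewrite mulrBl -mulrN -gN.
Qed.

Lemma minor2E (n : nat) (A : comNzRingType) (B : 'M[A]_(2, n.+1))
  (j k : 'I_n.+1) : minor2 B j k = B 0 j * B 1 k - B 0 k * B 1 j.
Proof.
rewrite /minor2 (expand_det_row _ 0) !big_ord_recl big_ord0 addr0 /cofactor.
rewrite !det_mx11 !mxE /= expr0 expr1 mulN1r !mul1r mulrN.
by congr (_ * B _ _ - _ * B _ _); apply: val_inj.
Qed.

(** * Chain rule for substituting univariate polynomials *)

Section PolyMmap.
Variables (F : fieldType) (r : nat) (h : 'I_r -> {poly F}).

Lemma horner_mmap (P : {mpoly F[r]}) (t : F) :
  (mmap polyC h P).[t] = P.@[fun x => (h x).[t]].
Proof.
rewrite mevalE /mmap horner_sum; apply: eq_bigr => m _.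
rewrite hornerM hornerC /mmap1 horner_prod; congr (_ * _).
by apply: eq_bigr => x _; rewrite horner_exp.
Qed.

(** The property [chain] holds for constants and variables and is stable under products, hence holds
    for monomials; sums follow by additivity. *)
Lemma deriv_mmap (P : {mpoly F[r]}) :
  (mmap polyC h P)^`() = \sum_(x < r) mmap polyC h P^`M(x) * (h x)^`().
Proof.
pose chain P := (mmap polyC h P)^`() = \sum_x mmap polyC h P^`M(x) * (h x)^`().
have chainC c : chain c%:MP.
  rewrite /chain mmapC derivC big1 // => x _.
  by rewrite mderivC mmap0 mul0r.
have chainM P1 P2 : chain P1 -> chain P2 -> chain (P1 * P2).
  rewrite /chain rmorphM derivM => -> ->.
  rewrite mulr_suml mulr_sumr -big_split; apply: eq_bigr => x _ /=.
  by rewrite mderivM rmorphD !rmorphM /=; ring.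
have chainXU y : chain 'X_y.
  rewrite /chain mmapX mmap1U (bigD1 y) //= mderivX mnm1E eqxx scale1r.
  have -> : (U_(y) - U_(y) = 0 :> 'X_{1..r})%MM.
    by apply/mnmP => z; rewrite mnmBE subnn mnm0E.
  rewrite mmapX mmap11 mul1r big1 ?addr0 // => x x_y.
  by rewrite mderivX mnm1E eq_sym (negPf x_y) scale0r mmap0 mul0r.
rewrite -/(chain P); elim/mpolyind: P => [|c m P _ _ chP].
  by rewrite -mpolyC0; apply: chainC.
rewrite /chain mmapD derivD.
have ->: (mmap polyC h (c *: 'X_[m]))^`() =
    \sum_x mmap polyC h (c *: 'X_[m])^`M(x) * (h x)^`().
  rewrite -mul_mpolyC; apply: (chainM) => //; rewrite mpolyXE_id.
  apply: (big_ind chain); [by rewrite -mpolyC1 | exact: chainM |].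
  move=> x _; elim: (m x) => [|k IH]; first by rewrite expr0 -mpolyC1.
  by rewrite exprS; apply: (chainM).
rewrite chP -big_split; apply: eq_bigr => x _ /=.
by rewrite mderivD mmapD mulrDl.
Qed.

End PolyMmap.

Lemma ord2_cases (a : 'I_2) : a = 0 \/ a = 1.
Proof. by case: a => [[|[|//]] lt_a2]; [left|right]; apply: val_inj. Qed.

(** * Lines, their bases and Plücker coordinates *)

Section Spans.
Variables (F : fieldType) (n : nat).
Implicit Types (B : 'M[F]_(2, n.+1)) (L : line F n).

Lemma mul_row2 (c : 'rV[F]_2) B : c *m B = c 0 0 *: row 0 B + c 0 1 *: row 1 B.
Proof.
apply/rowP => j; rewrite !mxE !big_ord_recl big_ord0 addr0.
by congr (_ + c _ _ * B _ _); apply: val_inj.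
Qed.

Lemma rows2 B : [seq row a B | a : 'I_2] = [:: row 0 B; row 1 B].
Proof.
rewrite /image_mem enum_ordSl enum_ordSl /=.
have /size0nil -> : size (enum 'I_0) = 0%N by rewrite size_enum_ord.
by congr [:: row _ B; row _ B]; apply: val_inj.
Qed.

Lemma free_rows B : free [seq row a B | a : 'I_2] = row_free B.
Proof.
have -> : [seq row a B | a : 'I_2] = [tuple row 0 B; row 1 B] by rewrite rows2.
apply/freeP/idP => [B_free|B_free k].
  apply: inj_row_free => c; rewrite mul_row2 => cB.
  apply/rowP => a; rewrite mxE; apply: B_free.
  rewrite !big_ord_recl big_ord0 addr0 /= -[RHS]cB.
  by congr (_ + c _ _ *: _); apply: val_inj.
rewrite !big_ord_recl big_ord0 addr0 /= => kB.
have /rowP k0 : (\row_a k a : 'rV_2) = 0.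
  apply: (row_free_inj B_free); rewrite mul0mx mul_row2 !mxE -[RHS]kB.
  by congr (_ + k _ *: _); apply: val_inj.
by move=> a; have := k0 a; rewrite !mxE.
Qed.

Lemma spans_row_free B L : spans B L -> row_free B.
Proof.
by move=> BL; rewrite -free_rows /free BL rows2; case: L {BL}.
Qed.

Lemma row_free_spans B : row_free B -> exists L, spans B L.
Proof.
rewrite -free_rows /free {2}rows2 => dimB.
by exists (@Line F n <<[seq row a B | a : 'I_2]>>%VS dimB).
Qed.

Lemma spans_memP B L (v : 'rV_n.+1) :
  spans B L -> reflect (exists c, v = c *m B) (v \in line_space L).
Proof.
move=> <-; rewrite rows2 span_cons span_seq1; apply: (iffP memv_addP).
  case=> _ /vlineP[c0 ->] [_ /vlineP[c1 ->] ->].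
  exists (\row_a if a == 0 then c0 else c1).
  by rewrite mul_row2 !mxE.
case=> c ->; rewrite mul_row2; exists (c 0 0 *: row 0 B); first exact: memvZ (memv_line _).
by exists (c 0 1 *: row 1 B) => //; apply: memvZ (memv_line _).
Qed.

Lemma row_free_minor B :
  row_free B <-> exists x, plucker B x != 0.
Proof.
split=> [B_free|[x]].
  have [x /= Bx|B0] := pickP (fun x => plucker B x != 0); first by exists x.
  have minor0 j k : B 0 j * B 1 k = B 0 k * B 1 j.
    wlog lt_jk : j k / (j < k)%N => [wlog_jk|].
      by case: (ltngtP j k) => [/wlog_jk//|/wlog_jk/esym//|/val_inj ->].
    have /negbT := B0 (enum_rank (exist _ (j, k) lt_jk : plucker_idx n)).
    by rewrite negbK /plucker enum_rankK /= minor2E subr_eq0 => /eqP.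
  have B_inj := row_free_inj B_free.
  have B0j j : B 0 j = 0.
    (* If all minors vanish, the entries of column j give a relation between the two rows, so
       freeness makes the first row zero. *)
    pose c : 'rV_2 := \row_a if a == 0 then B 1 j else - B 0 j.
    have /rowP/(_ 1) : c = 0.
      apply: B_inj; rewrite mul0mx mul_row2; apply/rowP => k.
      by rewrite !mxE /= mulNr minor0 [B 1 j * _]mulrC subrr.
    by rewrite !mxE /= => /eqP; rewrite oppr_eq0 => /eqP.
  have /rowP/(_ 0) : delta_mx 0 0 = 0 :> 'rV[F]_2.
    apply: B_inj; rewrite mul0mx -rowE; apply/rowP => j; rewrite !mxE.
    by rewrite B0j.
  by rewrite !mxE eqxx => /eqP; rewrite oner_eq0.
rewrite /plucker; case: (val _) => j k /=; rewrite minor2E => Bjk.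
apply: inj_row_free => c cB.
have e l : c 0 0 * B 0 l + c 0 1 * B 1 l = 0.
  by have /rowP/(_ l) := cB; rewrite mul_row2 !mxE.
(* Cramer's rule: multiplied by the nonzero minor, each coefficient is a combination of the
   relations at columns [j] and [k]. *)
apply/rowP => a; rewrite mxE; apply: (mulIf Bjk); rewrite mul0r.
have [->|->] := ord2_cases a.
  by transitivity ((c 0 0 * B 0 j + c 0 1 * B 1 j) * B 1 k
    - (c 0 0 * B 0 k + c 0 1 * B 1 k) * B 1 j); [ring | rewrite !e !mul0r subrr].
by transitivity ((c 0 0 * B 0 k + c 0 1 * B 1 k) * B 0 j
    - (c 0 0 * B 0 j + c 0 1 * B 1 j) * B 0 k); [ring | rewrite !e !mul0r subrr].
Qed.

End Spans.

(** * The differential of a polynomial along a pencil *)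

Section DirectionalDerivative.
Variables (F : fieldType) (n : nat).
Implicit Types (B D : 'M[F]_(2, n.+1)) (P Q : ppoly F n).

Lemma horner_pencil B D x t :
  (plucker (pencil B D) x).[t] = plucker (B + t *: D) x.
Proof.
rewrite /plucker; case: (val _) => j k /=.
by rewrite !minor2E !mxE hornerD hornerN !hornerM !hornerD !hornerM hornerX !hornerC.
Qed.

Lemma deriv_pencil B D x (jk := val (enum_val x)) :
  (plucker (pencil B D) x)^`().[0] =
  (D 0 jk.1 * B 1 jk.2 - D 1 jk.1 * B 0 jk.2) -
  (D 0 jk.2 * B 1 jk.1 - D 1 jk.2 * B 0 jk.1).
Proof.
rewrite /plucker -/jk; case: jk => j k /=; rewrite minor2E !mxE.
rewrite derivB !derivM !derivD !derivM !derivX !derivC.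
by rewrite !(hornerD, hornerN, hornerM, hornerX, hornerC); ring.
Qed.

Lemma dq_enum_val Q x (jk := val (enum_val x)) : dq Q jk.1 jk.2 = Q^`M(x).
Proof.
by rewrite /dq -surjective_pairing valK enum_valK.
Qed.

Definition grad Q B (j k : 'I_n.+1) : F := (dq Q j k - dq Q k j).@[plucker B].

Lemma gradN Q B j k : grad Q B k j = - grad Q B j k.
Proof. by rewrite /grad -mevalN opprB. Qed.

Lemma gradjj Q B j : grad Q B j j = 0.
Proof. by rewrite /grad subrr meval0. Qed.

(** With M = [grad Q B] and a, b the rows of [B], the columns are M a^T and M b^T. *)
Definition gradmx Q B : 'M[F]_(n.+1, 2) :=
  \matrix_(j, a) \sum_k grad Q B j k * B a k.

Definition diffq Q B D : F :=
  \sum_j (D 0 j * gradmx Q B j 1 - D 1 j * gradmx Q B j 0).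

(** By the chain rule this is a sum over j < k of derivatives of minors times entries of [grad]. The
    derivative of a minor is an antisymmetrization, so [sum_lt_antisym] turns the sum into one over
    all pairs. *)
Lemma dir_derivE Q B D : dir_deriv Q B D = diffq Q B D.
Proof.
rewrite /dir_deriv deriv_mmap horner_sum.
pose f j k := D 0 j * B 1 k - D 1 j * B 0 k.
transitivity (\sum_(j < n.+1) \sum_(k < n.+1 | (j < k)%N) (f j k - f k j) * grad Q B j k).
  rewrite -(big_plucker_idx (fun j k => (f j k - f k j) * grad Q B j k)).
  apply: eq_bigr => x _; rewrite hornerM horner_mmap deriv_pencil mulrC.
  rewrite /f /grad dq_enum_val [dq Q _ _]dq_ge ?subr0; last first.
    exact/ltnW/(valP (enum_val x)).
  by congr (_ * _); apply: meval_eq => y; rewrite horner_pencil scale0r addr0.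
rewrite sum_lt_antisym; [|exact: gradjj|exact: gradN].
apply: eq_bigr => j _; rewrite !mxE !mulr_sumr -sumrB.
by apply: eq_bigr => k _; rewrite /f; ring.
Qed.

Lemma diffqD Q B D1 D2 : diffq Q B (D1 + D2) = diffq Q B D1 + diffq Q B D2.
Proof.
by rewrite /diffq -big_split; apply: eq_bigr => j _ /=; rewrite !mxE; ring.
Qed.

Lemma dir_derivM P Q B D :
  dir_deriv (P * Q) B D =
  dir_deriv P B D * Q.@[plucker B] + P.@[plucker B] * dir_deriv Q B D.
Proof.
rewrite /dir_deriv rmorphM derivM hornerD !hornerM !horner_mmap.
by congr (_ * _ + _ * _); apply: meval_eq => x; rewrite horner_pencil scale0r addr0.
Qed.

Lemma dir_derivD P Q B D :
  dir_deriv (P + Q) B D = dir_deriv P B D + dir_deriv Q B D.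
Proof. by rewrite /dir_deriv rmorphD derivD hornerD. Qed.

Lemma plucker_mul (A : comNzRingType) (C : 'M[A]_2) (B : 'M[A]_(2, n.+1)) x :
  plucker (C *m B) x = \det C * plucker B x.
Proof.
rewrite /plucker /minor2 -det_mulmx; congr (\det _).
by apply/matrixP => a b; rewrite !mxE; apply: eq_bigr => c _; rewrite mxE.
Qed.

(** All Plücker coordinates of the pencil are scaled by [\det C], and [Q] is homogeneous. Tangency
    can thus be tested on a single basis of the line. *)
Lemma dir_deriv_mul d Q (C : 'M[F]_2) B D : Q \is d.-homog ->
  dir_deriv Q (C *m B) (C *m D) = \det C ^+ d * dir_deriv Q B D.
Proof.
move=> /dhomogP Qd; rewrite /dir_deriv.
suff -> : mmap polyC (plucker (pencil (C *m B) (C *m D))) Q =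
    (\det C ^+ d) *: mmap polyC (plucker (pencil B D)) Q by rewrite derivZ hornerZ.
have -> : pencil (C *m B) (C *m D) = map_mx polyC C *m pencil B D.
  by rewrite /pencil !map_mxM mulmxDr scalemxAr.
rewrite /mmap scaler_sumr big_seq [RHS]big_seq; apply: eq_bigr => m /Qd dm.
rewrite scalerAr; congr (_ * _); rewrite -mul_polyC /mmap1.
under eq_bigr do rewrite plucker_mul det_map_mx exprMn.
by rewrite big_split /= prodrXr -mdegE -dm rmorphXn.
Qed.

End DirectionalDerivative.

(** * Polynomials vanishing along a pencil *)

Section Vanishing.
Variables (F : numFieldType) (n : nat).
Implicit Types (B D : 'M[F]_(2, n.+1)) (L : line F n) (P Q : ppoly F n).

Lemma horner_eq0 (p : {poly F}) : (forall t, p.[t] = 0) -> p = 0.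
Proof.
move=> p0; apply/eqP; apply: contraT => nz_p.
(* In characteristic zero the naturals below [size p] are distinct, which is one root too many for a
   nonzero [p]. *)
have := max_poly_roots (rs := [seq k%:R | k <- iota 0 (size p)]) nz_p.
rewrite size_map size_iota ltnn; apply.
  by apply/allP => t _; rewrite rootE p0.
by rewrite map_inj_uniq ?iota_uniq // => j k /eqP; rewrite Num.Theory.eqr_nat => /eqP.
Qed.

(* Multiplying by a minor of B + t D takes care of the finitely many t at which
   B + t D has rank less than 2. *)
Lemma dir_deriv_eq0 P B D : row_free B ->
  (forall t L, spans (B + t *: D) L -> P.@[plucker (B + t *: D)] = 0) ->
  dir_deriv P B D = 0.
Proof.
move=> /row_free_minor[x Bx] P0.
suff P_eq0 : mmap polyC (plucker (pencil B D)) P = 0.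
  by rewrite /dir_deriv P_eq0 deriv0 horner0.
have /eqP : mmap polyC (plucker (pencil B D)) P * plucker (pencil B D) x = 0.
  apply: horner_eq0 => t; rewrite hornerM horner_mmap horner_pencil.
  have [->|Btx] := eqVneq (plucker (B + t *: D) x) 0; first by rewrite mulr0.
  have /row_free_minor/row_free_spans[L BL] : exists x, plucker (B + t *: D) x != 0.
    by exists x.
  rewrite (meval_eq _ (v2 := plucker (B + t *: D))) => [|y]; last exact: horner_pencil.
  by rewrite (P0 t L BL) mul0r.
rewrite mulf_eq0 => /orP[/eqP->//|/eqP x0]; case/negP: Bx.
by rewrite -[B]addr0 -(scale0r D) -horner_pencil x0 horner0.
Qed.

End Vanishing.

(** * Traces of endomorphisms *)

Section Trace.
Variables (F : fieldType) (V : vectType F).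

Lemma lftraceE (f : 'End(V)) :
  lftrace f = \sum_i coord (vbasis {:V}) i (f (vbasis {:V})`_i).
Proof.
by apply: eq_bigr => i _; rewrite /passmx.mxof !mxE /= passmx.vecof_delta.
Qed.

Lemma lftrace0 : lftrace (0 : 'End(V)) = 0.
Proof. by rewrite lftraceE big1 // => i _; rewrite lfunE linear0. Qed.

Lemma lftrace_is_linear c (f g : 'End(V)) : lftrace (c *: f + g) = c * lftrace f + lftrace g.
Proof.
rewrite !lftraceE mulr_sumr -big_split; apply: eq_bigr => i _.
by rewrite add_lfunE scale_lfunE linearD linearZ.
Qed.

(** The trace of a sum of rank-one maps: swap the sums and recombine the coordinates of each [w a].
    It allows a trace on the quotient to be computed through the two rows of [B]. *)
Lemma lftrace_sum (r : nat) (l : 'I_r -> V -> F) (w : 'I_r -> V) (f : 'End(V)) :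
  (forall a c u v, l a (c *: u + v) = c * l a u + l a v) ->
  (forall v, f v = \sum_a l a v *: w a) ->
  lftrace f = \sum_a l a (w a).
Proof.
move=> l_lin fE; rewrite lftraceE.
under eq_bigr do rewrite fE linear_sum /=.
rewrite exchange_big; apply: eq_bigr => a _ /=.
have l0 : l a 0 = 0.
  by have := l_lin a (-1) 0 0; rewrite scaler0 addr0 mulN1r addNr.
rewrite {2}(coord_vbasis (memvf (w a))).
have lD u v : l a (u + v) = l a u + l a v.
  by have := l_lin a 1 u v; rewrite scale1r mul1r.
rewrite (big_morph (l a) lD l0).
apply: eq_bigr => i _; rewrite linearZ /= mulrC.
by have := l_lin a (coord (vbasis {:V}) i (w a)) (vbasis {:V})`_i 0; rewrite !addr0 l0 addr0 => ->.
Qed.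

End Trace.

Lemma spans_exists (F : fieldType) (n : nat) (L : line F n) : exists B, spans B L.
Proof.
exists (\matrix_(a < 2) (vbasis (line_space L))`_a).
rewrite /spans rows2 !rowK /= -[RHS](span_basis (vbasisP _)); congr <<_>>%VS.
have: size (vbasis (line_space L)) = 2 by rewrite size_tuple; case: L => K /= /eqP.
by case: (tval _) => [|e0 [|e1 [|]]].
Qed.

(** * Tangent vectors at a line and the trace pairing *)

Section LineCriterion.
Variables (F : numFieldType) (n : nat) (Sigma : line F n -> Prop) (Q : ppoly F n).
Hypothesis Sigma_Q : given_by Sigma Q.
Implicit Types (L : line F n) (B D : 'M[F]_(2, n.+1)) (P : ppoly F n).

Local Notation U L := (subvs_of (line_space L)).
Local Notation V L := (quotv (line_space L)).

Lemma vanishes_on_Q : vanishes_on Q Sigma.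
Proof.
have [_ _ Sigma_ideal] := Sigma_Q; apply/Sigma_ideal.
by exists 1; rewrite mul1r subrr => L _ B _; rewrite meval0.
Qed.

Lemma spans_row_mem B L a : spans B L -> row a B \in line_space L.
Proof.
by move=> BL; apply/(spans_memP _ BL); exists (delta_mx 0 a); rewrite rowE.
Qed.

Lemma rows_mem_factor B D L : spans B L -> (forall a, row a D \in line_space L) ->
  exists C, D = C *m B.
Proof.
move=> BL DL; apply/submxP/row_subP => a.
have /(spans_memP _ BL)[c ->] := DL a.
exact: submxMl.
Qed.

(** The pencil equals (1 + tC) B, so wherever its rows span a line, that line is [L] itself, and [Q]
    vanishes there. *)
Lemma diffq_tangential B L C : Sigma L -> spans B L -> diffq Q B (C *m B) = 0.
Proof.
move=> SL BL; rewrite -dir_derivE; apply: dir_deriv_eq0; first exact: spans_row_free BL.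
move=> t L' sp; apply: (vanishes_on_Q SL); rewrite /spans sp; apply/eqP.
have dim2 (K : line F n) : \dim K = 2 by case: K => ? /= /eqP.
rewrite eqEdim !dim2 leqnn andbT; apply/subvP => v /(spans_memP _ sp)[c ->].
apply/(spans_memP _ BL); exists (c *m (1 + t *: C)).
by rewrite -mulmxA mulmxDl mul1mx scalemxAl.
Qed.

Lemma gradmx_euler B L : Sigma L -> spans B L ->
  \sum_j B 0 j * gradmx Q B j 1 = 0.
Proof.
move=> SL BL; rewrite -[RHS](diffq_tangential (delta_mx 0 0) SL BL).
apply: eq_bigr => j _.
by rewrite !mxE !big_ord_recl !big_ord0 !mxE /=; ring.
Qed.

Definition is_lift L (phi : 'Hom(U L, V L)) B D :=
  forall a : 'I_2, quotv_proj L (row a D) = phi (vsproj L (row a B)).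

Lemma is_lift_mul L (phi : 'Hom(U L, V L)) B C D :
  is_lift phi B D -> is_lift phi (C *m B) (C *m D).
Proof. by move=> BD a; rewrite !row_mul !mul_row2 !linearD !linearZ /= !BD. Qed.

(** Reduces the test over all polynomials, bases and lifts to [Q] and one lifted basis. Another
    basis is [C *m B], and another lift differs from [C *m D] by rows in [L], along which the
    differential of [Q] vanishes. *)
Lemma tangent_vectorP L (phi : 'Hom(U L, V L)) B D :
  Sigma L -> spans B L -> is_lift phi B D ->
  tangent_vector Sigma phi <-> diffq Q B D = 0.
Proof.
move=> SL BL BD; have [[d Qd] _ Sigma_ideal] := Sigma_Q.
split=> [|D0 P /Sigma_ideal[A PA] B' D' B'L].
  by move/(_ Q vanishes_on_Q B D BL BD); rewrite dir_derivE.
have [C defB'] : exists C, B' = C *m B.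
  by apply: (rows_mem_factor BL) => a; apply: spans_row_mem B'L.
rewrite {}defB' in B'L * => B'D'.
have [C' defD'] : exists C', D' - C *m D = C' *m (C *m B).
  apply: (rows_mem_factor B'L) => a.
  rewrite -[line_space L]quotv_proj_ker memv_ker !linearB /=.
  by rewrite B'D' (is_lift_mul C BD) subrr.
(* Write P = (P - AQ) + AQ: the first summand vanishes on all lines, and the second has derivative A
   dQ because Q is zero at the line. *)
rewrite -[P](subrK (A * Q)) dir_derivD dir_derivM [dir_deriv (P - _) _ _]dir_deriv_eq0.
- have -> : Q.@[plucker (C *m B)] = 0 by apply: vanishes_on_Q B'L.
  rewrite mulr0 !add0r -[D'](subrK (C *m D)) defD' dir_derivE diffqD.
  by rewrite (diffq_tangential _ SL B'L) add0r -dir_derivE (dir_deriv_mul _ _ _ Qd)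
    dir_derivE D0 !mulr0.
- exact: spans_row_free B'L.
- by move=> t L' sp; apply: PA sp.
Qed.

Lemma meval_coisotropy_poly L B (i m : 'I_n.+1) : Sigma L -> spans B L ->
  (i < m)%N ->
  (coisotropy_poly Q i m).@[plucker B] =
  gradmx Q B i 1 * gradmx Q B m 0 - gradmx Q B i 0 * gradmx Q B m 1.
Proof.
move=> SL BL lt_im; set G := gradmx Q B.
pose g j k := pfaffian4 (grad Q B) j k i m.
have gN j k : g k j = - g j k.
  by rewrite /g /pfaffian4 (gradN Q B j k); ring.
(* A Pfaffian with a repeated index is zero, so the sum may be extended to the pairs that meet i or
   m. *)
have g0 j k : (j \in [:: i; m]) || (k \in [:: i; m]) -> g j k = 0.
  rewrite !inE /g /pfaffian4 => /orP[] /orP[] /eqP->.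
  - by rewrite gradjj (gradN Q B i k); ring.
  - by rewrite gradjj (gradN Q B i m) (gradN Q B k m); ring.
  - by rewrite gradjj; ring.
  - by rewrite gradjj (gradN Q B i m); ring.
have gjj j : g j j = 0.
  by rewrite /g /pfaffian4 gradjj; ring.
have eval_term (j k : 'I_n.+1) : (j < k)%N ->
    j \notin [:: i; m] -> k \notin [:: i; m] ->
    (qvar F j k * Rpoly Q j k i m).@[plucker B] =
    (B 0 j * B 1 k - B 0 k * B 1 j) * g j k.
  move=> lt_jk jim kim; rewrite mevalM Rpoly_pfaffian; last first.
    rewrite /= !inE negb_or -!val_eqE /= (ltn_eqF lt_jk) (ltn_eqF lt_im) /=.
    by move: jim kim; rewrite !inE => -> ->.
  rewrite /pfaffian4 mevalD mevalB !mevalM; congr (_ * _).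
  by rewrite /qvar insubT /= mevalXU /plucker enum_rankK /= minor2E.
transitivity (\sum_(j < n.+1) \sum_(k < n.+1 | (j < k)%N)
    (B 0 j * B 1 k - B 0 k * B 1 j) * g j k).
  rewrite /coisotropy_poly raddf_sum big_mkcond /=; apply: eq_bigr => j _.
  case: ifP => [jim|/negbFE jim]; last first.
    by rewrite big1 // => k _; rewrite g0 ?jim ?mulr0.
  rewrite raddf_sum big_mkcondr /=; apply: eq_bigr => k lt_jk.
  case: ifP => [kim|/negbFE kim]; last by rewrite g0 ?kim ?orbT ?mulr0.
  exact: eval_term.
rewrite sum_lt_antisym //.
(* The summands come from the three terms of the Pfaffian, in the order first, third, second; the
   Euler relation kills the first. *)
transitivity (grad Q B i m * (\sum_j B 0 j * G j 1) + G i 1 * G m 0 - G i 0 * G m 1);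
  last by rewrite (gradmx_euler SL BL) mulr0 add0r.
have GE a j : G j a = \sum_k grad Q B j k * B a k by rewrite mxE.
under eq_bigr do under eq_bigr do rewrite /g /pfaffian4.
rewrite (GE 1 i) (GE 0 m) (GE 0 i) (GE 1 m) {lt_im}.
move: (grad Q B) (gradN Q B) GE {gN g0 gjj eval_term}@g => h hN GE.
rewrite [X in _ + X - _]mulrC !mulr_suml mulr_sumr -big_split -sumrB /=.
apply: eq_bigr => j _; rewrite GE !mulr_sumr -big_split -sumrB /=.
by apply: eq_bigr => k _; rewrite (hN j i) (hN k i) (hN j m) (hN k m); ring.
Qed.

(** The lift with values in the complement that models the quotient. *)
Definition row_lift L (phi : 'Hom(U L, V L)) B : 'M[F]_(2, n.+1) :=
  \matrix_(a < 2) vsval (phi (vsproj L (row a B))).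

Lemma is_lift_row_lift L (phi : 'Hom(U L, V L)) B :
  is_lift phi B (row_lift phi B).
Proof.
move=> a; rewrite rowK; apply: val_inj; rewrite /= val_quotv_proj.
set w := phi _; suff -> : projv L (vsval w) = 0 by rewrite subr0.
by apply/eqP; rewrite -memv_ker lker_proj subvsP.
Qed.

(** On the line, [pinvmx B] reads off coordinates in the rows of [B], so every matrix [D] is the
    lift of a tangent vector. *)
Definition hom_of_lift L B D : 'Hom(U L, V L) :=
  (quotv_proj L \o linfun (mulmxr (pinvmx B *m D)) \o linfun (@vsval _ _ L))%VF.

Lemma hom_of_liftE L B D (c : 'rV_2) : spans B L ->
  hom_of_lift L B D (vsproj L (c *m B)) = quotv_proj L (c *m D).
Proof.
move=> BL; rewrite !comp_lfunE !lfunE /= vsprojK; last by apply/(spans_memP _ BL); exists c.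
by rewrite mulmxA -(mulmxA c) mulmxVp ?mulmx1 // (spans_row_free BL).
Qed.

Lemma is_lift_hom_of_lift L B D : spans B L -> is_lift (hom_of_lift L B D) B D.
Proof. by move=> BL a; rewrite (rowE a B) hom_of_liftE // -rowE. Qed.

(* Its columns are M b^T and - M a^T, so that the differential of Q at B is
   D |-> \tr (D *m normal_mx B). *)
Definition normal_mx B : 'M[F]_(n.+1, 2) :=
  \matrix_(j, a) if a == 0 then gradmx Q B j 1 else - gradmx Q B j 0.

(** The differential of [Q] under the trace pairing: the equation of the tangent hyperplane at
    smooth lines. *)
Definition normal_hom L B : 'Hom(V L, U L) :=
  (linfun (vsproj L) \o linfun (mulmxr (normal_mx B *m B))
     \o linfun (@vsval _ _ (line_space L)^C))%VF.

Lemma normal_homE L B v :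
  normal_hom L B v = vsproj L (vsval v *m normal_mx B *m B).
Proof. by rewrite !comp_lfunE !lfunE /= mulmxA. Qed.

Lemma diffqE B D : diffq Q B D = \sum_a (D *m normal_mx B) a a.
Proof.
rewrite !big_ord_recl big_ord0 addr0 !mxE -big_split; apply: eq_bigr => j _ /=.
rewrite !mxE /= mulrN.
by congr (_ - D _ _ * _); apply: val_inj.
Qed.

Lemma lftrace_normal_hom L B (phi : 'Hom(U L, V L)) :
  lftrace (phi \o normal_hom L B)%VF = diffq Q B (row_lift phi B).
Proof.
rewrite diffqE (lftrace_sum (l := fun a v => (vsval v *m normal_mx B) 0 a)
  (w := fun a => phi (vsproj L (row a B)))).
- by apply: eq_bigr => a _; rewrite !mxE; apply: eq_bigr => j _; rewrite !mxE.
- by move=> a c u v; rewrite linearP /= mulmxDl -scalemxAl !mxE.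
- move=> v; rewrite comp_lfunE normal_homE.
  by rewrite (mulmx_sum_row _ B) !linear_sum; apply: eq_bigr => a _; rewrite !linearZ.
Qed.

Lemma tangent_vector_normal L B (phi : 'Hom(U L, V L)) : Sigma L -> spans B L ->
  tangent_vector Sigma phi <-> lftrace (phi \o normal_hom L B)%VF = 0.
Proof.
by move=> SL BL; rewrite lftrace_normal_hom; apply: tangent_vectorP (is_lift_row_lift _ _).
Qed.

Lemma tangent_hom_of_lift L B D : Sigma L -> spans B L ->
  lftrace (hom_of_lift L B D \o normal_hom L B)%VF = 0 <-> diffq Q B D = 0.
Proof.
move=> SL BL; rewrite -tangent_vector_normal //.
by apply: tangent_vectorP (is_lift_hom_of_lift _ _).
Qed.

End LineCriterion.

(** * Kernels of trace forms, and matrices of rank at most one *)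

Section HyperplaneOfTrace.
Variables (F : fieldType) (U V : vectType F) (psi : 'Hom(V, U)).

Definition trace_form (phi : 'Hom(U, V)) : F^o := lftrace (phi \o psi)%VF.

Lemma trace_form_linear : linear trace_form.
Proof.
by move=> c phi1 phi2; rewrite /trace_form comp_lfunDl -comp_lfunZl lftrace_is_linear.
Qed.

HB.instance Definition _ := GRing.isLinear.Build F 'Hom(U, V) F^o _ trace_form
  trace_form_linear.

(** Rank-nullity: a nonzero form has one-dimensional image. *)
Lemma trace_kernel_hyperplane : (exists phi, trace_form phi != 0) ->
  is_hyperplane (lker (linfun trace_form)).
Proof.
case=> phi phi_neq0; rewrite /is_hyperplane.
rewrite -(limg_ker_dim (linfun trace_form) fullv) capfv -addn1; congr (_ + _)%N.
apply/esym/eqP; rewrite eqn_leq; apply/andP; split.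
  by apply: leq_trans (dimvS (subvf _)) _; rewrite dimvf.
rewrite lt0n dimv_eq0; apply: contraNneq phi_neq0 => img0.
by rewrite -memv0 -img0 -lfunE memv_img ?memvf.
Qed.

End HyperplaneOfTrace.

(** Given a nonzero entry [N i a], each column is a multiple of column [a], with multipliers the
    entries of row [i] divided by [N i a]. *)
Lemma rank1_factor (F : fieldType) (r s : nat) (N : 'M[F]_(r, s)) :
  (forall i j a b, N i a * N j b = N i b * N j a) ->
  exists (u : 'cV_r) (v : 'rV_s), N = u *m v.
Proof.
move=> N_minors; have [->|/matrix0Pn[i [a Nia]]] := eqVneq N 0.
  by exists 0, 0; rewrite mulmx0.
exists (col a N), ((N i a)^-1 *: row i N); apply/matrixP => j b.
rewrite !mxE big_ord1 !mxE; apply: (mulfI Nia).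
by rewrite N_minors mulrCA [_ * N j a]mulrC; field.
Qed.

(** * Coisotropy as vanishing of the minors of [gradmx] *)

Section Coisotropy.
Variables (F : numFieldType) (n : nat) (Sigma : line F n -> Prop) (Q : ppoly F n).
Hypothesis Sigma_Q : given_by Sigma Q.

Lemma normal_mx_minors (B : 'M[F]_(2, n.+1)) :
  (forall i m : 'I_n.+1, gradmx Q B i 1 * gradmx Q B m 0 =
                         gradmx Q B i 0 * gradmx Q B m 1) ->
  forall i j a b, normal_mx Q B i a * normal_mx Q B j b =
                  normal_mx Q B i b * normal_mx Q B j a.
Proof.
move=> G_minors i j a b.
have NE k c : normal_mx Q B k c =
    if c == 0 then gradmx Q B k 1 else - gradmx Q B k 0 by rewrite mxE.
by rewrite !NE; case: ifP => _; case: ifP => _; rewrite ?mulrN ?mulNr ?G_minors.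
Qed.

Lemma normal_hom_rank1 (L : line F n) (B : 'M[F]_(2, n.+1)) :
  (forall i m : 'I_n.+1, gradmx Q B i 1 * gradmx Q B m 0 =
                         gradmx Q B i 0 * gradmx Q B m 1) ->
  (\dim (limg (normal_hom Q L B)) <= 1)%N.
Proof.
move=> /normal_mx_minors/rank1_factor[u [v uv]].
have sub_line : (limg (normal_hom Q L B) <= <[vsproj L (v *m B)]>)%VS.
  apply/subvP => _ /memv_imgP[w _ ->]; rewrite normal_homE uv !mulmxA.
  rewrite [_ *m u]mx11_scalar -mulmxA mul_scalar_mx linearZ.
  exact: memvZ (memv_line _).
apply: leq_trans (dimvS sub_line) _; rewrite dim_vline; exact: leq_b1.
Qed.

(** If [gradmx] is nonzero, the kernel of the trace form is a tangent hyperplane, so coisotropy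
    provides a rank-one equation. The generator of its image has coordinates [c] in the rows of [B],
    and these are the coefficients of a relation between the columns of [gradmx]. *)
Lemma coisotropic_at_minors (L : line F n) (B : 'M[F]_(2, n.+1)) :
  coisotropic Sigma -> Sigma L -> spans B L ->
  forall i m : 'I_n.+1,
    gradmx Q B i 1 * gradmx Q B m 0 = gradmx Q B i 0 * gradmx Q B m 1.
Proof.
move=> coiso SL BL i m; set G := gradmx Q B.
have [G0|/matrix0Pn[j [a Gja]]] := eqVneq G 0.
  by rewrite G0 !mxE !mulr0.
pose psi := normal_hom Q L B; pose T := lker (linfun (trace_form psi)).
have T_mem phi : (phi \in T) = (trace_form psi phi == 0).
  by rewrite memv_ker lfunE.
have T_tangent : is_tangent_space Sigma T.
  move=> phi; rewrite T_mem; split=> [/eqP|] tg.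
    exact/(tangent_vector_normal Sigma_Q phi SL BL).
  by apply/eqP/(tangent_vector_normal Sigma_Q phi SL BL).
have T_hyper : is_hyperplane T.
  apply: trace_kernel_hyperplane.
  (* The differential pairs each row of [D] with the opposite column of [G], so this [D] detects
     [G j a] up to sign. *)
  exists (hom_of_lift L B (delta_mx (1 - a) j)); apply: contra Gja => /eqP.
  move/(tangent_hom_of_lift Sigma_Q _ SL BL).
  rewrite /diffq (bigD1 j) //= big1 => [|k k_j]; last first.
    by rewrite !mxE (negPf k_j) !andbF !mul0r subr0.
  have DE b : (delta_mx (1 - a) j : 'M[F]_(2, n.+1)) b j = (b == 1 - a)%:R.
    by rewrite mxE eqxx andbT.
  rewrite !DE addr0.
  have [->|->] := ord2_cases a; rewrite ?subr0 ?subrr /= ?mul0r ?mul1r ?subr0 ?sub0r -/G;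
    by move/eqP; rewrite ?oppr_eq0.
have [_ [psi' [rk1 T_psi']]] : hyperplane_coisotropic T.
  by apply: coiso => //; split=> //; exists T.
have [u0 u0_neq0 img_u0] : exists2 u0, u0 != 0 & limg psi' = <[u0]>%VS.
  exists (vpick (limg psi')); first by rewrite vpick0 -dimv_eq0 rk1.
  apply/esym/eqP; rewrite eqEdim rk1 dim_vline vpick0 -dimv_eq0 rk1 andbT.
  by rewrite -memvE memv_pick.
have /(spans_memP _ BL)[c u0_c] := subvsP u0.
(* The homs lifted from D with c *m D = 0 kill the image <[u0]> of psi', hence
   are tangent; they are numerous enough to force a relation between the
   columns of G. *)
have c_G k : c 0 1 * G k 1 + c 0 0 * G k 0 = 0.
  (* With e_k the k-th unit vector, the rows are c_1 e_k and - c_0 e_k: they cancel in [c *m D], and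
     the differential at [D] is the left side of the relation. *)
  pose D : 'M[F]_(2, n.+1) :=
    \matrix_(b, l) ((if b == 0 then c 0 1 else - c 0 0) * (l == k)%:R).
  have cD : c *m D = 0.
    by apply/rowP => l; rewrite mul_row2 !mxE /=; ring.
  have : hom_of_lift L B D \in T.
    have: hom_of_lift L B D u0 = 0.
      by rewrite -[u0]vsvalK u0_c hom_of_liftE // cD linear0.
    rewrite T_psi'; move: (hom_of_lift L B D) => phi phi_u0.
    suff -> : (phi \o psi')%VF = 0 by exact: lftrace0.
    apply/lfunP => w; rewrite comp_lfunE lfunE /=.
    have : psi' w \in limg psi' by rewrite memv_img ?memvf.
    rewrite img_u0 => /vlineP[s ->].
    by rewrite linearZ /= phi_u0 scaler0.
  rewrite T_mem => /eqP/(tangent_hom_of_lift Sigma_Q _ SL BL).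
  rewrite /diffq (bigD1 k) //= big1 => [|l l_k]; last first.
    by rewrite !mxE (negPf l_k) !mulr0 !mul0r subr0.
  have DE b : D b k = if b == 0 then c 0 1 else - c 0 0 by rewrite mxE eqxx mulr1.
  by rewrite !DE addr0 /= mulNr opprK.
have [c0|c0] := eqVneq (c 0 0) 0.
  have c1 : c 0 1 != 0.
    apply: contra u0_neq0 => /eqP c1; rewrite -(inj_eq val_inj) /= u0_c mul_row2.
    by rewrite c0 c1 !scale0r addr0.
  have G1 k : G k 1 = 0.
    by apply: (mulfI c1); have := c_G k; rewrite c0 mul0r addr0 mulr0.
  by rewrite !G1 mul0r mulr0.
apply: (mulfI c0).
transitivity (G i 1 * (c 0 1 * G m 1 + c 0 0 * G m 0)
  - (c 0 1 * G i 1 + c 0 0 * G i 0) * G m 1 + c 0 0 * (G i 0 * G m 1)).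
  by ring.
by rewrite !c_G mulr0 mul0r subrr add0r.
Qed.

Lemma minors_coisotropic :
  (forall (L : line F n) (B : 'M[F]_(2, n.+1)), Sigma L -> spans B L ->
   forall i m : 'I_n.+1,
     gradmx Q B i 1 * gradmx Q B m 0 = gradmx Q B i 0 * gradmx Q B m 1) ->
  coisotropic Sigma.
Proof.
move=> G_minors L [SL [T' [T'_tangent T'_hyper]]] T T_tangent.
have T_hyper : is_hyperplane T.
  suff -> : T = T' by [].
  by apply/vspaceP => phi; apply/idP/idP => [/T_tangent/T'_tangent|/T'_tangent/T_tangent].
split=> //.
have [B BL] := spans_exists L.
exists (normal_hom Q L B).
have T_psi phi : phi \in T <-> lftrace (phi \o normal_hom Q L B)%VF = 0.
  by rewrite -(tangent_vector_normal Sigma_Q phi SL BL).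
split=> //; apply/eqP; rewrite eqn_leq normal_hom_rank1 /=; last exact: G_minors SL BL.
(* Rank zero is excluded: every [phi] would be tangent, and [T] would be the full space instead of a
   hyperplane. *)
rewrite lt0n dimv_eq0; apply/negP => /eqP img0.
have psi0 w : normal_hom Q L B w = 0.
  by apply/eqP; rewrite -memv0 -img0 memv_img ?memvf.
have T_full : T = fullv.
  apply/vspaceP => phi; rewrite memvf; apply/T_psi.
  suff -> : (phi \o normal_hom Q L B)%VF = 0 by exact: lftrace0.
  by apply/lfunP => w; rewrite comp_lfunE psi0 linear0 lfunE.
by move/eqP: T_hyper; rewrite T_full -[X in _ == X]addn0 -addn1 eqn_add2l.
Qed.

End Coisotropy.

Theorem theorem31 (R : realType) (n : nat) (n_ge3 : (3 <= n)%N)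
    (Sigma : line R[i] n -> Prop) (Q : ppoly R[i] n)
    (Sigma_hyp : irreducible_hypersurface Sigma)
    (Sigma_Q : given_by Sigma Q) :
  coisotropic Sigma <->
  (forall i m : 'I_n.+1, (i < m)%N ->
   forall L : line R[i] n, Sigma L -> vanishes (coisotropy_poly Q i m) L).
Proof.
split=> [coiso i m lt_im L SL B BL|Q_van].
  rewrite (meval_coisotropy_poly Sigma_Q SL BL lt_im).
  by rewrite (coisotropic_at_minors Sigma_Q coiso SL BL) subrr.
apply: (minors_coisotropic Sigma_Q) => L B SL BL i m.
have Q_minor (j k : 'I_n.+1) : (j < k)%N ->
    gradmx Q B j 1 * gradmx Q B k 0 = gradmx Q B j 0 * gradmx Q B k 1.
  move=> lt_jk; apply/eqP; rewrite -subr_eq0.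
  by rewrite -(meval_coisotropy_poly Sigma_Q SL BL lt_jk) (Q_van _ _ lt_jk L SL B BL).
(* Swapping i and m only changes the sign of the minor, and i = m is trivial. *)
case: (ltngtP i m) => [/Q_minor//|/Q_minor|/val_inj ->]; last exact: mulrC.
by rewrite ![gradmx Q B m _ * _]mulrC => ->.
Qed.
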